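(* Let $a,b$ be positive integers, and let $F_n(q)$ and $\widehat{F}_n(q)$ be the sequences defined in the context. For all integers $n\geq 0$ and $k\geq 1$, $$F_n(q)\widehat{F}_{n+k}(q)-F_{n+k}(q)\widehat{F}_{n}(q) =(-1)^{n-1}q^{\binom n2}\sum_{j=0}^{k-1}{k-1-j\brack j}\, a^{\left\lfloor\frac{k-1}{2}\right\rfloor + \xi(k+1)\xi(n+1)-j}\,b^{\left\lfloor\frac{k-1}{2}\right\rfloor + \xi(k+1)\xi(n)-j}\,q^{j^2+nj}.$$
   Context: Fix positive integers $a,b$; $q$ is an indeterminate. The $q$-biperiodic Fibonacci sequence is defined by $F_0(q)=0$, $F_1(q)=1$ and, for $n\geq 2$, $F_n(q)=aF_{n-1}(q)+q^{n-2}F_{n-2}(q)$ if $n$ is even, $F_n(q)=bF_{n-1}(q)+q^{n-2}F_{n-2}(q)$ if $n$ is odd. The sequence $\widehat{F}_n(q)$ satisfies the same recurrence for $n\geq 2$, namely $\widehat{F}_n(q)=a\widehat{F}_{n-1}(q)+q^{n-2}\widehat{F}_{n-2}(q)$ if $n$ is even and $\widehat{F}_n(q)=b\widehat{F}_{n-1}(q)+q^{n-2}\widehat{F}_{n-2}(q)$ if $n$ is odd, with initial values $\widehat{F}_0(q)=1$, $\widehat{F}_1(q)=0$. For an integer $n$, $\xi(n)=n-2\lfloor n/2\rfloor$ (so $\xi(n)=0$ if $n$ is even and $1$ if $n$ is odd). The $q$-binomial coefficient is ${n\brack k}=\frac{[n]_q!}{[k]_q!\,[n-k]_q!}$ for $0\leq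 k\leq n$ and ${n\brack k}=0$ for $k<0$ or $k>n\geq 0$, where $[n]_q=1+q+\cdots+q^{n-1}$ and $[n]_q!=[1]_q[2]_q\cdots[n]_q$, $[0]_q!=1$. Terms with vanishing $q$-binomial coefficient are zero (even if the exponents of $a$ or $b$ are negative). *)

(* Defs.v *)
From HB Require Import structures.
From mathcomp Require Import all_boot all_order all_algebra.

Set Implicit Arguments.
Unset Strict Implicit.
Unset Printing Implicit Defensive.

Import Order.TTheory GRing.Theory Num.Theory.
Local Open Scope ring_scope.

(* The field Q(q) of rational functions, with q its indeterminate: the
   sequences live in Z[q], while q-binomial coefficients and integer powers
   of a and b are quotients. *)
Notation ratfun := {fraction {poly rat}}.
Definition qvar : ratfun := tofrac 'X.

Section QAnalogues.
Variables (K : fieldType) (q : K).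

Definition qint (n : nat) : K := \sum_(i < n) q ^+ i.

Definition qfact (n : nat) : K := \prod_(1 <= i < n.+1) qint i.

Definition qbinom (n k : nat) : K :=
  if (k <= n)%N then qfact n / (qfact k * qfact (n - k)) else 0.

Fixpoint qbiperiodic (a b : nat) (x0 x1 : K) (n : nat) : K :=
  match n with
  | 0 => x0
  | 1 => x1
  | (m.+1 as p).+1 =>
      (if odd n then b%:R else a%:R) * qbiperiodic a b x0 x1 p
      + q ^+ m * qbiperiodic a b x0 x1 m
  end.

Definition qF (a b n : nat) : K := qbiperiodic a b 0 1 n.

Definition qFhat (a b n : nat) : K := qbiperiodic a b 1 0 n.

End QAnalogues.

Definition xi (n : int) : int := n - 2 * (n %/ 2)%Z.

(* Main.v *)
(* For fixed n, both sides satisfy the same second-order recurrence in k: the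
   left-hand side because F and Fhat do, the sum because of the q-Pascal rule
   [n+1, j+1] = [n, j+1] + q^(n-j) [n, j].  At k = 1 the left-hand side is the
   Casoratian of F and Fhat, a product computed by induction on n. *)
Require Import Defs.
From HB Require Import structures.
From mathcomp Require Import all_boot all_order all_algebra.
From mathcomp Require Import zify ring.

Set Implicit Arguments.
Unset Strict Implicit.
Unset Printing Implicit Defensive.

Import Order.TTheory GRing.Theory Num.Theory.
Local Open Scope ring_scope.

Section QBinomial.
Variables (K : fieldType) (q : K).

Lemma qintD (m n : nat) : qint q (m + n) = qint q m + q ^+ m * qint q n.
Proof.
rewrite /qint big_split_ord /= big_distrr /=; congr (_ + _).
by apply: eq_bigr => i _; rewrite exprD.
Qed.

Lemma qfactS (n : nat) : qfact q n.+1 = qfact q n * qint q n.+1.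
Proof. by rewrite /qfact big_nat_recr. Qed.

Hypothesis qint_neq0 : forall n, qint q n.+1 != 0.

Lemma qfact_neq0 (n : nat) : qfact q n != 0.
Proof.
elim: n => [|n IHn]; first by rewrite /qfact big_geq ?oner_eq0.
by rewrite qfactS mulf_neq0.
Qed.

Lemma qbinom0 (n : nat) : qbinom q n 0 = 1.
Proof.
by rewrite /qbinom subn0 {2}/qfact big_geq // mul1r divff // qfact_neq0.
Qed.

Lemma qbinom_small (n k : nat) : (n < k)%N -> qbinom q n k = 0.
Proof. by rewrite /qbinom ltnNge => /negbTE->. Qed.

Lemma qbinomnn (n : nat) : qbinom q n n = 1.
Proof.
by rewrite /qbinom leqnn subnn {3}/qfact big_geq // mulr1 divff // qfact_neq0.
Qed.

(** For [k < n], split [n+1] as [n-k] + q^(n-k) [k+1] and multiply by [n]! / ([k+1]! [n-k]!). The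
    case [n = k] stands apart because [n, n+1] is zero by convention. *)
Lemma qbinomS (n k : nat) :
  qbinom q n.+1 k.+1 = qbinom q n k.+1 + q ^+ (n - k) * qbinom q n k.
Proof.
case: (ltngtP n k) => [ltnk|ltkn|->].
- by rewrite !qbinom_small ?mulr0 ?addr0 // ltnS ltnW.
- rewrite /qbinom ltnS (ltnW ltkn) ltkn subSS.
  have -> : (n - k = (n - k.+1).+1)%N by lia.
  have En : (n.+1 = (n - k.+1).+1 + k.+1)%N by lia.
  rewrite (qfactS n) {1}En qintD !qfactS.
  have := (qfact_neq0 k, qfact_neq0 (n - k.+1)).
  have := (qint_neq0 k, qint_neq0 (n - k.+1)).
  move=> [? ?] [? ?]; field.
  by apply/and4P.
- by rewrite !qbinomnn qbinom_small // subnn mul1r add0r.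
Qed.

End QBinomial.

Section QBiperiodic.
Variables (K : fieldType) (q : K) (a b : nat).

(** Indexed by the lower end of the recurrence: the step to [n.+2] depends on the parity of [n]. *)
Definition qcoef (n : nat) : K := if odd n then b%:R else a%:R.

Lemma qbiperiodicSS (x0 x1 : K) (n : nat) :
  qbiperiodic q a b x0 x1 n.+2 =
    qcoef n * qbiperiodic q a b x0 x1 n.+1
    + q ^+ n * qbiperiodic q a b x0 x1 n.
Proof. by rewrite /qcoef /= negbK. Qed.

Definition qwronskian (m n : nat) : K :=
  qF q a b m * qFhat q a b n - qF q a b n * qFhat q a b m.

Lemma qwronskianSS (m n : nat) :
  qwronskian m n.+2 = qcoef n * qwronskian m n.+1 + q ^+ n * qwronskian m n.
Proof. by rewrite /qwronskian /qF /qFhat !qbiperiodicSS; ring. Qed.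

Lemma qwronskian_diag (n : nat) : qwronskian n n = 0.
Proof. by rewrite /qwronskian mulrC subrr. Qed.

Lemma qwronskianC (m n : nat) : qwronskian m n = - qwronskian n m.
Proof. by rewrite /qwronskian; ring. Qed.

(** In the recurrence the diagonal term vanishes, so each step multiplies by -q^n; the exponents add
    up to 0 + 1 + ... + (n-1). *)
Lemma qwronskianS (n : nat) :
  qwronskian n n.+1 = (-1) ^+ n.+1 * q ^+ 'C(n, 2).
Proof.
elim: n => [|n IHn]; first by rewrite /qwronskian /qF /qFhat /=; ring.
rewrite qwronskianSS qwronskian_diag qwronskianC IHn binS bin1 exprD.
by rewrite (exprS _ n.+1); ring.
Qed.

Hypothesis qint_neq0 : forall n, qint q n.+1 != 0.
Hypotheses (a_neq0 : a%:R != 0 :> K) (b_neq0 : b%:R != 0 :> K).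

(* Summand of the theorem for k = m + 1, where floor((k-1)/2) = m./2 and
   xi(k+1) = odd m. *)
Definition qbterm (n m j : nat) : K :=
  qbinom q (m - j) j
  * a%:R ^ ((m./2 + odd m * ~~ odd n)%N%:Z - j%:Z)
  * b%:R ^ ((m./2 + odd m * odd n)%N%:Z - j%:Z)
  * q ^+ (j ^ 2 + n * j).

(** Raising [m] by one raises exactly one exponent by one: that of [b] if [n + m] is odd, that of
    [a] otherwise. Exponents may be negative, hence the need for nonzero [a] and [b]. *)
Lemma qcoef_expz (n m j : nat) :
  qcoef (n + m) * (a%:R ^ ((m./2 + odd m * ~~ odd n)%N%:Z - j%:Z)
    * b%:R ^ ((m./2 + odd m * odd n)%N%:Z - j%:Z))
  = a%:R ^ ((m.+1./2 + odd m.+1 * ~~ odd n)%N%:Z - j%:Z)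
    * b%:R ^ ((m.+1./2 + odd m.+1 * odd n)%N%:Z - j%:Z).
Proof.
have expa x y : a%:R * (a%:R ^ x * b%:R ^ y) = a%:R ^ (x + 1) * b%:R ^ y :> K.
  by rewrite expfzDr // expr1z; ring.
have expb x y : b%:R * (a%:R ^ x * b%:R ^ y) = a%:R ^ x * b%:R ^ (y + 1) :> K.
  by rewrite expfzDr // expr1z; ring.
rewrite /qcoef oddD /= uphalf_half.
by case: (odd m); case: (odd n); rewrite /= ?expa ?expb;
  congr (_ ^ _ * _ ^ _); lia.
Qed.

Lemma qbterm_diag (n m : nat) : qbterm n m.+1 m.+1 = 0.
Proof. by rewrite /qbterm subnn qbinom_small // !mul0r. Qed.

Lemma qbterm_recl (n m : nat) : qbterm n m.+1 0 = qcoef (n + m) * qbterm n m 0.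
Proof.
by rewrite /qbterm !subn0 !qbinom0 // !mul1r -qcoef_expz; ring.
Qed.

(** The q-Pascal rule on [m-j+1, j+1]; its factor q^(m-2j) combines with (j+1)^2 + n(j+1) to give
    (n+m+1) + j^2 + nj. *)
Lemma qbtermSS (n m j : nat) : (j <= m)%N ->
  qbterm n m.+2 j.+1 =
    qcoef (n + m.+1) * qbterm n m.+1 j.+1 + q ^+ (n + m.+1) * qbterm n m j.
Proof.
move=> lejm; rewrite /qbterm.
have -> : (m.+2 - j.+1 = (m - j).+1)%N by lia.
rewrite qbinomS // mulrDl mulrDl mulrDl subSS; congr (_ + _).
  by rewrite -[_ * a%:R ^ _ * _]mulrA -qcoef_expz; ring.
(* When [m - j < j] the exponent [m - j - j] is truncated to 0, but then [m-j, j] vanishes. *)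
have [lt_mj|le_jm] := ltnP (m - j) j.
  by rewrite qbinom_small //; ring.
have Eexp x : (m.+2./2 + odd m.+2 * x)%N%:Z - j.+1%:Z
    = (m./2 + odd m * x)%N%:Z - j%:Z by rewrite /= negbK; lia.
rewrite !{}Eexp.
have -> : (j.+1 ^ 2 + n * j.+1 = (j ^ 2 + n * j) + (n + j.*2.+1))%N by lia.
have -> : (n + m.+1 = (m - j - j) + (n + j.*2.+1))%N by lia.
by rewrite !(exprD _ _ (n + _)); ring.
Qed.

Definition qbsum (n m : nat) : K := \sum_(0 <= j < m.+1) qbterm n m j.

Lemma qbsumSS (n m : nat) :
  qbsum n m.+2 = qcoef (n + m.+1) * qbsum n m.+1 + q ^+ (n + m.+1) * qbsum n m.
Proof.
(* The terms [j = 0] are matched separately and the last term on the left is zero; what remains on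
   both sides has [m.+1] terms. *)
rewrite /qbsum big_nat_recl // big_nat_recr //= [in RHS]big_nat_recl //.
rewrite qbterm_diag addr0 mulrDr qbterm_recl -addrA; congr (_ + _).
rewrite !big_distrr -big_split /=.
by apply: eq_big_nat => j /andP[_ ltjm]; rewrite qbtermSS.
Qed.

Lemma qwronskianE (n m : nat) :
  qwronskian n (n + m.+1) = (-1) ^+ n.+1 * q ^+ 'C(n, 2) * qbsum n m.
Proof.
pose c : K := (-1) ^+ n.+1 * q ^+ 'C(n, 2).
(* The recurrence has order two, so the induction carries two consecutive values. *)
suff: qwronskian n (n + m.+1) = c * qbsum n m
   /\ qwronskian n (n + m.+2) = c * qbsum n m.+1 by case.
have qbterm00 : qbterm n 0 0 = 1.
  by rewrite /qbterm qbinom0 // muln0 addn0 !mulr1.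
elim: m => [|m [IHm IHm1]]; split=> //.
- by rewrite addn1 qwronskianS /qbsum big_nat1 qbterm00 mulr1.
- rewrite addn2 qwronskianSS qwronskian_diag qwronskianS /qbsum.
  rewrite big_nat_recr //= big_nat1 qbterm_recl // qbterm00 addn0.
  by rewrite qbterm_diag /c; ring.
- by rewrite 2!addnS qwronskianSS -!addnS IHm IHm1 qbsumSS addnS; ring.
Qed.

End QBiperiodic.

Lemma natr_ratfun_neq0 (n : nat) : (0 < n)%N -> n%:R != 0 :> ratfun.
Proof.
move=> n_gt0; rewrite -(rmorph_nat (@tofrac {poly rat})) tofrac_eq0.
by rewrite -polyC_natr polyC_eq0 pnatr_eq0 -lt0n.
Qed.

(** As a polynomial in q it takes the value n+1 at q = 1, which is nonzero in the rationals. *)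
Lemma qint_qvar_neq0 (n : nat) : qint qvar n.+1 != 0.
Proof.
have -> : qint qvar n.+1 = tofrac (\sum_(i < n.+1) 'X^i).
  by rewrite rmorph_sum; apply: eq_bigr => i _; rewrite rmorphXn.
rewrite tofrac_eq0; apply/eqP => /(congr1 (fun p : {poly rat} => p.[1])).
rewrite horner_sum horner0 (eq_bigr (fun=> 1)) => [/eqP|i _].
  by rewrite sumr_const card_ord pnatr_eq0.
by rewrite hornerXn expr1n.
Qed.

Lemma xi_nat (n : nat) : xi n%:Z = odd n.
Proof. by rewrite /xi; lia. Qed.

Theorem theorem4 (a b : nat) (a_gt0 : (0 < a)%N) (b_gt0 : (0 < b)%N)
    (n k : nat) (k_ge1 : (1 <= k)%N) :
  qF qvar a b n * qFhat qvar a b (n + k)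
    - qF qvar a b (n + k) * qFhat qvar a b n
  = (-1) ^ (n%:Z - 1) * qvar ^+ 'C(n, 2) *
    \sum_(0 <= j < k)
      qbinom qvar (k - 1 - j) j
      * a%:R ^ (((k%:Z - 1) %/ 2)%Z + xi (k%:Z + 1) * xi (n%:Z + 1) - j%:Z)
      * b%:R ^ (((k%:Z - 1) %/ 2)%Z + xi (k%:Z + 1) * xi n%:Z - j%:Z)
      * qvar ^+ (j ^ 2 + n * j).
Proof.
case: k k_ge1 => // m _.
have := qwronskianE qint_qvar_neq0 (natr_ratfun_neq0 a_gt0)
  (natr_ratfun_neq0 b_gt0) n m.
rewrite /qwronskian => ->; congr (_ * _ * _).
  (* The integer exponent n-1 is negative at [n = 0]; since -1 is its own inverse, it may be
     replaced by n+1. *)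
  by rewrite expfzDr ?oppr_eq0 ?oner_eq0 // -[X in _ * X]/((-1)^-1) invrN1 exprSr.
have -> : ((m.+1%:Z - 1) %/ 2)%Z = m./2 by lia.
have -> : m.+1%:Z + 1 = m.+2 by lia.
have -> : n%:Z + 1 = n.+1 by lia.
rewrite !xi_nat /= negbK; apply: eq_bigr => j _.
by rewrite /qbterm subn1 !PoszD !PoszM.
Qed.
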